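(* For every simplicial complex $\Delta$ on vertex set $\mathsf{V}=\{1,\dots,n\}$ and every $i\ge 1$, the scheme structure on the support resonance $\mathcal{R}_i(\Delta)=\operatorname{Spec}\bigl(S/\operatorname{Ann}W_i(\Delta)\bigr)$ is reduced. Moreover, its decomposition into irreducible components is given by $$\mathcal{R}_i(\Delta)=\bigcup_{\substack{\mathsf{V}'\subseteq\mathsf{V}\text{ maximal with}\\ \widetilde{H}_{i-1}(\Delta_{\mathsf{V}'};\Bbbk)\neq 0}}\Bbbk^{\mathsf{V}'}.$$
   Context: $\Bbbk$ is a field of characteristic $0$ and $S=\Bbbk[x_1,\dots,x_n]$ with the $\mathbb{N}^n$-grading $\deg x_i=\mathbf{e}_i$ (the $i$-th standard basis vector). A simplicial complex $\Delta$ on vertex set $[n]=\{1,\dots,n\}$ is a collection of subsets (faces) of $[n]$ closed under taking subsets and containing $\emptyset$ and all singletons $\{i\}$. Koszul modules: let $V$ be a $\Bbbk$-vector space with basis $v_1,\dots,v_n$, $\deg v_i=\mathbf{e}_i$, and let $\mathbf{K}_\bullet=\bigwedge^\bullet V\otimes_\Bbbk S$ be the Koszul complex of $x_1,\dots,x_n$, with differential $\partial(v_{j_1}\wedge\cdots\wedge v_{j_i})=\sum_{k}(-1)^{k-1}x_{j_k}\,v_{j_1}\wedge\cdots\widehat{v_{j_k}}\cdots\wedge v_{j_i}$. Let $\mathbf{K}^\Delta_\bullet\subseteq\mathbf{K}_\bullet$ be the subcomplex whose $i$-th term is the free $S$-module generated by those $v_{j_1}\wedge\cdots\wedge v_{j_i}$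 with $\{j_1,\dots,j_i\}\in\Delta$. Then $W_i(\Delta):=H_i(\mathbf{K}^\Delta_\bullet)$, an $\mathbb{N}^n$-graded $S$-module. For $\mathsf{V}'\subseteq\mathsf{V}$, $\Delta_{\mathsf{V}'}=\{\tau\in\Delta\mid\tau\subseteq\mathsf{V}'\}$; $\Bbbk^{\mathsf{V}'}$ denotes the coordinate subspace of $\Bbbk^n=\operatorname{Spec}S$ defined by the vanishing of $x_i$ for $i\notin\mathsf{V}'$. ''Maximal'' refers to inclusion among subsets with the stated non-vanishing property. $\widetilde{H}$ denotes reduced simplicial homology. *)

(* Defs.v *)
From HB Require Import structures.
From mathcomp Require Export all_boot all_order all_algebra.
From mathcomp Require Export ring_quotient.
From mathcomp Require Export boolp classical_sets.
From mathcomp Require Export mpoly.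

#[export] Set Implicit Arguments.
#[export] Unset Strict Implicit.
#[export] Unset Printing Implicit Defensive.

Import GRing.Theory.

Local Open Scope classical_set_scope.
Local Open Scope ring_scope.

Section Spectrum.

Variable R : comNzRingType.

(* [prime_idealr] consists of boolean predicates; classically this is no
   restriction, so [Spec] has all the prime ideals of R as points. *)
Definition Spec : Type := prime_idealr R.

Definition zero_locus (J : set R) : set Spec :=
  [set p : Spec | forall f, J f -> f \in (p : {pred R})].

Definition zariski_closed (Z : set Spec) : Prop :=
  exists J : set R, Z = zero_locus J.

Definition irreducible (Z : set Spec) : Prop :=
  Z !=set0 /\
  forall A B, zariski_closed A -> zariski_closed B ->
    Z `<=` A `|` B -> Z `<=` A \/ Z `<=` B.

Definition irreducible_components (X : set Spec) : set (set Spec) :=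
  [set Z | [/\ Z `<=` X, irreducible Z &
    forall Z', Z' `<=` X -> irreducible Z' -> Z `<=` Z' -> Z' = Z]].

(* The kernel of R -> (R/I)_p: f/1 is zero in the local ring of Spec (R/I)
   at p iff it is killed by some element outside p. *)
Definition stalk_kernel (I : set R) (p : Spec) : set R :=
  [set f | exists2 s, s \notin (p : {pred R}) & I (s * f)].

(* The scheme Spec (R/I), with underlying space the zero locus of I in Spec R,
   is reduced: no local ring (R/I)_p has a nonzero nilpotent. As denominators
   are units of (R/I)_p, it is enough to consider elements of the form f/1. *)
Definition reduced_closed_subscheme (I : set R) : Prop :=
  forall p, zero_locus I p ->
  forall (f : R) (m : nat), stalk_kernel I p (f ^+ m) -> stalk_kernel I p f.

End Spectrum.

Definition simplicial_complex (n : nat) (D : {set {set 'I_n}}) : Prop :=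
  [/\ finset.set0 \in D,
      forall j : 'I_n, [set j]%SET \in D &
      forall s t : {set 'I_n}, t \subset s -> s \in D -> t \in D].

Definition restrict (n : nat) (D : {set {set 'I_n}}) (V : {set 'I_n}) :
  {set {set 'I_n}} := [set s in D | s \subset V]%SET.

Section Chains.

Variables (R : comNzRingType) (n : nat).

(* The free R-module on the subsets of [n]; a subset {j_1 < ... < j_i} stands
   for v_{j_1} /\ ... /\ v_{j_i}, or for the oriented simplex [j_1, ..., j_i]. *)
Definition chain : lmodType R := {ffun {set 'I_n} -> R^o}.

Definition basis_elt (s : {set 'I_n}) : chain := [ffun t => (t == s)%:R].

(* If j = j_k in s = {j_1 < ... < j_i}, then k - 1 elements of s precede j. *)
Definition bd_basis (w : 'I_n -> R) (s : {set 'I_n}) : chain :=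
  \sum_(j in s)
    ((-1) ^+ #|[set l in s | (l < j)%N]%SET| * w j) *: basis_elt (s :\ j)%SET.

(* The weights w are the variables x_j for the Koszul complex, and 1 for the
   augmented simplicial chain complex. *)
Definition bd (w : 'I_n -> R) (c : chain) : chain :=
  \sum_(s : {set 'I_n}) c s *: bd_basis w s.

Definition chain_on (D : {set {set 'I_n}}) (i : nat) : set chain :=
  [set c : chain | forall s, c s != 0 -> s \in D /\ #|s| = i].

Definition cycles (w : 'I_n -> R) (D : {set {set 'I_n}}) (i : nat) :
  set chain := [set z | chain_on D i z /\ bd w z = 0].

Definition boundaries (w : 'I_n -> R) (D : {set {set 'I_n}}) (i : nat) :
  set chain := [set z | exists2 c, chain_on D i.+1 c & z = bd w c].

End Chains.

(* Simplices of dimension d are sets of cardinality d + 1; the empty face is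
   a simplex of dimension -1, so this is reduced homology. *)
Definition reduced_homology_neq0 (k : fieldType) (n : nat)
    (D : {set {set 'I_n}}) (d : nat) : Prop :=
  exists2 z : chain k n, cycles (fun=> 1) D d.+1 z
                       & ~ boundaries (fun=> 1) D d.+1 z.

Section Resonance.

Variables (k : fieldType) (n : nat).

Local Notation S := {mpoly k[n]}.

Definition koszul_cycles (D : {set {set 'I_n}}) (i : nat) : set (chain S n) :=
  cycles (fun j => 'X_j) D i.

Definition koszul_boundaries (D : {set {set 'I_n}}) (i : nat) :
  set (chain S n) := boundaries (fun j => 'X_j) D i.

(* The annihilator of the Koszul module
   W_i(D) = koszul_cycles D i / koszul_boundaries D i. *)
Definition ann_W (D : {set {set 'I_n}}) (i : nat) : set S :=
  [set f | forall z, koszul_cycles D i z -> koszul_boundaries D i (f *: z)].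

Definition support_resonance (D : {set {set 'I_n}}) (i : nat) : set (Spec S) :=
  zero_locus (ann_W D i).

Definition coordinate_subspace (V : {set 'I_n}) : set (Spec S) :=
  zero_locus [set f | exists2 j : 'I_n, j \notin V & f = 'X_j].

Definition maximal_nonacyclic (D : {set {set 'I_n}}) (d : nat) :
  set {set 'I_n} :=
  [set V | reduced_homology_neq0 k (restrict D V) d /\
    forall V' : {set 'I_n}, reduced_homology_neq0 k (restrict D V') d ->
      V \subset V' -> V' = V].

End Resonance.

Arguments ann_W k {n} D i _.
Arguments support_resonance k {n} D i _.
Arguments coordinate_subspace k {n} V _.
Arguments maximal_nonacyclic k {n} D d _.

(* Main.v *)
From HB Require Import structures.
Require Import Defs.
From mathcomp Require Import all_boot all_order all_algebra.
From mathcomp Require Import ring_quotient boolp classical_sets mpoly.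

(** Everything about W_i(D) can be read off one multidegree at a time. In
multidegree a, the Koszul chain groups have the basis of the elements
x^(a - e_s) v_s, where s runs over the faces of D contained in the set of
variables of x^a and e_s is the exponent of the squarefree monomial of s.
Forgetting the monomial x^(a - e_s) turns the Koszul differential into the
augmented simplicial one, so the part of W_i(D) of multidegree a is the
reduced homology in degree i - 1 of D restricted to the variables of x^a, and
multiplication by a monomial is the map induced by an inclusion of vertex sets.

Hence a monomial x^m kills W_i(D) exactly when no vertex set V with
nonvanishing homology contains all the variables of x^m: if V does, x^m acts
as the identity between the multidegrees e_V and e_V + m; if no V does, x^m
maps every multidegree to one whose homology is zero. As both arguments work
for all the monomials of a polynomial simultaneously, the annihilator consists
of the polynomials none of whose monomials has all its variables in such a V
([ann_W_msuppP]). In other words it is the intersection, over the maximal V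
with nonvanishing homology, of the kernels of the ring morphisms which send to
0 the variables outside V ([ann_W_restrict_vars]).

The rest is formal. These kernels are prime ideals, so their intersection is
radical; a prime that contains a finite intersection of ideals contains one of
them; and the kernel attached to V is the generic point of the coordinate
subspace of V, so that this subspace is irreducible and inclusions between
coordinate subspaces are inclusions between vertex sets. An antichain of
finitely many irreducible closed sets consists of the irreducible components
of its union ([irreducible_components_bigcup]). *)

Import GRing.Theory.
Local Open Scope classical_set_scope.
Local Open Scope ring_scope.

(** * Weighted boundary maps *)

(** The coefficient formula, obtained by exchanging the sums over the faces s
and over the vertices j removed from s: t arises as s :\ j only for j outside
t and s = j |: t. *)
Lemma bdE (R : comNzRingType) (n : nat) (w : 'I_n -> R) (c : chain R n)
    (t : {set 'I_n}) :
  bd w c t = \sum_(j | j \notin t)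
    (-1) ^+ #|[set l in j |: t | (l < j)%N]%SET| * w j * c (j |: t)%SET.
Proof.
have -> : bd w c t = \sum_s c s * bd_basis w s t.
  by rewrite /bd sum_ffunE; apply: eq_bigr => s _; rewrite ffunE.
under eq_bigr => s _.
  rewrite /bd_basis sum_ffunE big_distrr /= big_mkcond /=.
  over.
rewrite exchange_big /= [RHS]big_mkcond /=; apply: eq_bigr => j _.
rewrite (bigD1 (j |: t)%SET) //= setU11 big1 => [|s ne_s].
  rewrite addr0 !ffunE; have [jt|jt] := boolP (j \in t) => /=.
    suff /negbTE-> : t != ((j |: t) :\ j)%SET by rewrite scaler0 mulr0.
    by apply: contraTneq jt => ->; rewrite !inE eqxx.
  by rewrite finset.setU1K // eqxx [_ *: _]mulr1 mulrC.
case: ifP => // js; rewrite !ffunE.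
suff /negbTE-> : t != (s :\ j)%SET by rewrite scaler0 mulr0.
by apply: contraNneq ne_s => ->; rewrite finset.setD1K.
Qed.

Lemma bd_is_linear (R : comNzRingType) (n : nat) (w : 'I_n -> R) :
  linear (bd w : chain R n -> chain R n).
Proof.
move=> b c d; apply/ffunP => t; rewrite !ffunE !bdE.
rewrite scaler_sumr -big_split /=; apply: eq_bigr => j _; rewrite !ffunE.
by rewrite mulrDr; congr (_ + _); rewrite [in LHS]mulrCA.
Qed.

HB.instance Definition _ (R : comNzRingType) (n : nat) (w : 'I_n -> R) :=
  GRing.isLinear.Build R (chain R n) (chain R n) _ (bd w) (bd_is_linear w).

(** * Exponents and their variables *)

Definition mvars (n : nat) (m : 'X_{1..n}) : {set 'I_n} :=
  [set j | m j != 0%N]%SET.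

Definition squarefree_mnm (n : nat) (s : {set 'I_n}) : 'X_{1..n} :=
  [multinom (j \in s : nat) | j < n].

Lemma mvars_squarefree (n : nat) (s : {set 'I_n}) :
  mvars (squarefree_mnm s) = s.
Proof. by apply/setP => j; rewrite inE mnmE; case: (j \in s). Qed.

Lemma mvarsD (n : nat) (m1 m2 : 'X_{1..n}) :
  mvars (m1 + m2)%MM = (mvars m1 :|: mvars m2)%SET.
Proof. by apply/setP => j; rewrite !inE mnmDE addn_eq0 negb_and. Qed.

Lemma squarefree_lepm (n : nat) (s : {set 'I_n}) (m : 'X_{1..n}) :
  (squarefree_mnm s <= m)%MM = (s \subset mvars m).
Proof.
apply/mnm_lepP/fintype.subsetP => [h j js|h j].
  by have := h j; rewrite inE mnmE js lt0n.
by rewrite mnmE; case js : (j \in s) => //; have := h j js; rewrite inE lt0n.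
Qed.

Lemma squarefreeU1 (n : nat) (j : 'I_n) (s : {set 'I_n}) : j \notin s ->
  squarefree_mnm (j |: s)%SET = (squarefree_mnm s + U_(j))%MM.
Proof.
move=> js; apply/mnmP => l; rewrite mnmDE mnm1E !mnmE !inE eq_sym.
by have [<-|] := eqVneq j l; rewrite ?(negbTE js) ?addn0.
Qed.

Lemma mcoeffXUM (R : comNzRingType) (n : nat) (j : 'I_n) (p : {mpoly R[n]}) m :
  ('X_j * p)@_m = if j \in mvars m then p@_(m - U_(j))%MM else 0.
Proof.
rewrite inE mulrC; case: ifPn => [mj|]; last first.
  rewrite negbK => /eqP mj; apply: memN_msupp_eq0.
  rewrite (perm_mem (msuppMX p U_(j))); apply/mapP => -[m' _ eq_m].
  by move: mj; rewrite eq_m mnmDE mnm1E eqxx.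
have le_jm : (U_(j) <= m)%MM by rewrite lep1mP.
by rewrite -[m in LHS](submK le_jm) addmC mcoeffMX.
Qed.

Lemma mcoeff_signM (R : nzRingType) (n q : nat) (p : {mpoly R[n]}) m :
  ((-1) ^+ q * p)@_m = (-1) ^+ q * p@_m.
Proof.
by elim: q => [|q IHq]; rewrite ?mul1r // !exprS !mulN1r !mulNr mcoeffN IHq.
Qed.

(** * Multigraded strands of the Koszul complex *)

Section Strands.

Variables (k : fieldType) (n : nat).
Local Notation S := {mpoly k[n]}.
Implicit Types (a b m : 'X_{1..n}) (D : {set {set 'I_n}}) (i : nat).
Implicit Types (V : {set 'I_n}) (f : S).

(** The coefficients at x^(a - e_s) v_s, that is, the component of
multidegree a. The test on s matters: the subtraction of exponents is
truncated, so without it other multidegrees would be picked up. *)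
Definition strand (a : 'X_{1..n}) (c : chain S n) : chain k n :=
  [ffun s : {set 'I_n} =>
     if s \subset mvars a then (c s)@_(a - squarefree_mnm s)%MM else 0].

(** The homogeneous Koszul chain of multidegree a with given coefficients. *)
Definition unstrand (a : 'X_{1..n}) (z : chain k n) : chain S n :=
  [ffun s : {set 'I_n} =>
     if s \subset mvars a then z s *: 'X_[a - squarefree_mnm s] else 0].

Lemma strand_is_additive a : zmod_morphism (strand a).
Proof.
move=> c d; apply/ffunP => s; rewrite !ffunE.
by case: ifP; rewrite ?subr0 // mcoeffB.
Qed.

HB.instance Definition _ a :=
  GRing.isZmodMorphism.Build (chain S n) (chain k n) (strand a)
    (strand_is_additive a).

(** The coefficient of c at x^m v_s occurs in multidegree m + e_s. *)
Lemma strand_inj (c d : chain S n) :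
  (forall a, strand a c = strand a d) -> c = d.
Proof.
move=> eq_cd; apply/ffunP => s; apply/mpolyP => m.
have := eq_cd (m + squarefree_mnm s)%MM => /ffunP/(_ s); rewrite !ffunE.
by rewrite mvarsD mvars_squarefree finset.subsetUr addmK.
Qed.

Definition multidegrees (c : chain S n) : seq 'X_{1..n} :=
  undup [seq (m + squarefree_mnm s)%MM
    | s <- enum {set 'I_n}, m <- msupp (c s)].

Lemma strand_eq0 (c : chain S n) a :
  a \notin multidegrees c -> strand a c = 0.
Proof.
rewrite mem_undup => a_notin; apply/ffunP => s; rewrite !ffunE.
case: ifP => // sa.
apply: memN_msupp_eq0; apply: contra a_notin => m_in.
apply/allpairsPdep; exists s, (a - squarefree_mnm s)%MM.
by rewrite mem_enum submK ?squarefree_lepm.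
Qed.

Lemma strand_unstrand a b D i (z : chain k n) :
  chain_on (restrict D (mvars a)) i z ->
  strand b (unstrand a z) = if a == b then z else 0.
Proof.
move=> z_on; apply/ffunP => s; rewrite !ffunE.
have [zs|/z_on[]] := eqVneq (z s) 0.
  rewrite zs scale0r if_same mcoeff0 if_same.
  by case: eqP; rewrite ?ffunE.
rewrite inE => /andP[_ sa] _; rewrite sa mcoeffZ mcoeffX.
have [<-|ne_ab] := eqVneq a b; first by rewrite eqxx mulr1 sa.
rewrite ffunE; case: ifP => // sb; case: eqP; rewrite ?mulr0 // => eq_ab.
case/eqP: ne_ab; rewrite -(@submK _ (squarefree_mnm s) a).
  by rewrite eq_ab submK ?squarefree_lepm.
by rewrite squarefree_lepm.
Qed.

(** The key point: x_j x^(a - e_s) = x^(a - e_t) when t = s :\ j, so the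
variables in the Koszul differential disappear. If x_j does not divide x^a,
then j |: t contributes to neither side. *)
Lemma strand_bd a (c : chain S n) :
  strand a (bd (fun j => 'X_j) c) = bd (fun=> 1) (strand a c).
Proof.
apply/ffunP => t; rewrite bdE ffunE.
under [RHS]eq_bigr => j jt do
  rewrite ffunE finset.subUset finset.sub1set mulr1.
have [ta|_] := boolP (t \subset mvars a); last first.
  by rewrite big1 // => j _; rewrite andbF mulr0.
rewrite bdE raddf_sum /=; apply: eq_bigr => j jt.
rewrite andbT -mulrA mcoeff_signM mcoeffXUM squarefreeU1 // submDA.
by rewrite !inE mnmBE mnmE (negbTE jt) subn0.
Qed.

Lemma strand_chain_on a D i (c : chain S n) :
  chain_on D i c -> chain_on (restrict D (mvars a)) i (strand a c).
Proof.
move=> c_on s; rewrite ffunE inE; case: ifP; rewrite ?eqxx // => sa c_s.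
have/c_on[-> //] : c s != 0.
by apply: contraNneq c_s => ->; rewrite mcoeff0.
Qed.

Lemma unstrand_chain_on a D i (z : chain k n) :
  chain_on (restrict D (mvars a)) i z -> chain_on D i (unstrand a z).
Proof.
move=> z_on s; rewrite ffunE; case: ifP; rewrite ?eqxx // => sa z_s.
have/z_on[/setIdP[sD _] //] : z s != 0.
by apply: contraNneq z_s => ->; rewrite scale0r.
Qed.

(** A nonzero product of a monomial of f and a monomial of c lies in a
multidegree whose variables include those of a monomial of f. *)
Lemma strand_scale_eq0 a f (c : chain S n) :
  (forall m, m \in msupp f -> ~~ (mvars m \subset mvars a)) ->
  strand a (f *: c) = 0.
Proof.
move=> f_a; apply/ffunP => s; rewrite !ffunE; case: ifP => // sa.
apply: memN_msupp_eq0; apply/negP => /msuppM_le/allpairsP[[m1 m2] /=].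
move=> [/f_a/negP m1a _ eq_a]; apply: m1a.
apply/fintype.subsetP => j; rewrite !inE => m1j.
have := congr1 (fun m : 'X_{1..n} => m j) eq_a; rewrite mnmBE mnmDE.
by case: (a j) => //; rewrite sub0n; case: (m1 j) m1j.
Qed.

(** From multidegree e_V to multidegree m + e_V, f acts through its coefficient
at x^m only. If V contains the variables of x^m, both multidegrees have the
same strand, that of D restricted to V. *)
Lemma strand_scale_unstrand D i V m f (z : chain k n) :
  mvars m \subset V -> chain_on (restrict D V) i z ->
  strand (m + squarefree_mnm V)%MM (f *: unstrand (squarefree_mnm V) z) =
  f@_m *: z.
Proof.
move=> mV z_on; apply/ffunP => s.
rewrite !ffunE mvarsD !mvars_squarefree (finset.setUidPr mV).
case: ifPn => [sV|/negbTE sV]; last first.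
  have [->|/z_on[/setIdP[_]]] := eqVneq (z s) 0; first by rewrite scaler0.
  by rewrite sV.
rewrite sV -addmBA ?squarefree_lepm ?mvars_squarefree //.
rewrite -[X in X@__]/(f * (z s *: _)) -scalerAr mcoeffZ addmC.
by rewrite mcoeffMX [RHS]mulrC.
Qed.

(** The Koszul complex is the direct sum of its strands, so boundaries can be
recognized on each of them; only the finitely many multidegrees of g
contribute to the preimage. *)
Lemma koszul_boundary_of_strands D i (g : chain S n) :
  (forall a, boundaries (fun=> 1) (restrict D (mvars a)) i (strand a g)) ->
  koszul_boundaries D i g.
Proof.
move=> g_bd; have /choice[c c_P] : forall a, exists c,
    chain_on (restrict D (mvars a)) i.+1 c /\ strand a g = bd (fun=> 1) c.
  by move=> a; have [c] := g_bd a; exists c.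
exists (\sum_(a <- multidegrees g) unstrand a (c a)).
  move=> s; rewrite sum_ffunE => sum_s.
  have /hasP[a _ a_s] :
      has (fun a => unstrand a (c a) s != 0) (multidegrees g).
    apply: contraNT sum_s => /hasPn g0; rewrite big_seq big1 // => a /g0.
    by rewrite negbK => /eqP.
  by apply: unstrand_chain_on a_s; case: (c_P a).
apply: strand_inj => b; rewrite strand_bd raddf_sum raddf_sum /=.
under eq_bigr => a _ do rewrite (strand_unstrand b (c_P a).1).
have [b_g|b_g] := boolP (b \in multidegrees g).
  rewrite (bigD1_seq b) ?undup_uniq //= eqxx big1 ?addr0 => [|a /negbTE->].
    by case: (c_P b).
  by rewrite raddf0.
rewrite strand_eq0 // big_seq big1 // => a a_g.
by case: eqP a_g b_g => [-> ->|]; rewrite ?raddf0.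
Qed.

Lemma ann_W_msuppP D i f : (0 < i)%N ->
  ann_W k D i f <->
  forall V, reduced_homology_neq0 k (restrict D V) i.-1 ->
    forall m, m \in msupp f -> ~~ (mvars m \subset V).
Proof.
move=> i_gt0; rewrite /reduced_homology_neq0 prednK //; split.
  move=> f_ann V [z [z_on bd_z] z_nbd] m m_f; apply/negP => mV.
  set e := squarefree_mnm V.
  have e_on : chain_on (restrict D (mvars e)) i z by rewrite mvars_squarefree.
  have z_cycle : koszul_cycles D i (unstrand e z).
    split; first exact: unstrand_chain_on.
    apply: strand_inj => a; rewrite strand_bd raddf0.
    by rewrite (strand_unstrand _ e_on); case: eqP; rewrite ?raddf0.
  have [c c_on fz] := f_ann _ z_cycle.
  (* In multidegree m + e, the equation fz exhibits f@_m z as a boundary. *)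
  apply: z_nbd; exists ((f@_m)^-1 *: strand (m + e)%MM c).
    move=> s; rewrite ffunE mulf_eq0 negb_or => /andP[_].
    have := strand_chain_on (a := m + e) c_on.
    by rewrite mvarsD mvars_squarefree (finset.setUidPr mV); apply.
  rewrite linearZ /= -strand_bd -fz (strand_scale_unstrand _ mV z_on).
  by rewrite scalerA mulVf ?scale1r // -mcoeff_msupp.
move=> f_V z [z_on bd_z]; apply: koszul_boundary_of_strands => a.
apply: contrapT => fz_nbd; have fz_n0 : strand a (f *: z) != 0.
  apply/eqP => fz0; apply: fz_nbd; exists 0; rewrite ?fz0 ?raddf0 //.
  by move=> s; rewrite ffunE eqxx.
move: fz_n0; rewrite strand_scale_eq0 ?eqxx //; apply: f_V.
exists (strand a (f *: z)) => //; split.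
  apply: strand_chain_on => s; rewrite ffunE => fzs; apply: z_on.
  by apply: contraNneq fzs => ->; rewrite scaler0.
by rewrite -strand_bd linearZ /= bd_z scaler0 raddf0.
Qed.

End Strands.

(** * Irreducible closed subsets of a spectrum *)

Section SpectrumTopology.

Variable R : comNzRingType.
Implicit Types (p q : Spec R) (Z A B : set (Spec R)).

Lemma zariski_closed0 : zariski_closed (@classical_sets.set0 (Spec R)).
Proof.
exists [set 1]; apply/seteqP; split=> // p /(_ 1 erefl).
by rewrite idealr1.
Qed.

Lemma zariski_closedU A B :
  zariski_closed A -> zariski_closed B -> zariski_closed (A `|` B).
Proof.
move=> [I ->] [J ->].
exists [set h | exists2 f, I f & exists2 g, J g & h = f * g].
apply/seteqP; split=> p.
  move=> [] K_p h [f If [g Jg ->]]; rewrite prime_idealrM.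
    by rewrite K_p.
  by rewrite (K_p g) ?orbT.
move=> IJ_p; have [I_p|] := pselect (zero_locus I p); first by left.
move=> /existsNP[f /not_implyP[If /negP f_p]]; right=> g Jg.
have : f * g \in (p : {pred R}) by apply: IJ_p; exists f => //; exists g.
by rewrite prime_idealrM (negbTE f_p).
Qed.

(** A closed set that contains the generic point q contains all of Z. *)
Lemma irreducible_generic_point Z q :
  Z q ->
  (forall p, Z p -> forall f, f \in (q : {pred R}) -> f \in (p : {pred R})) ->
  irreducible Z.
Proof.
move=> Zq q_gen; split=> [|A B [I ->] [J ->] Z_AB]; first by exists q.
by case: (Z_AB q Zq) => K_q; [left|right] => p /q_gen q_p f /K_q /q_p.
Qed.

(** By induction on the number of closed sets that cover Z, splitting off one
at a time. *)
Lemma irreducible_sub_bigcup (T : finType) (P : set T)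
    (F : T -> set (Spec R)) Z :
  irreducible Z -> (forall t, P t -> zariski_closed (F t)) ->
  Z `<=` \bigcup_(t in P) F t -> exists2 t, P t & Z `<=` F t.
Proof.
move=> [Z_n0 Z_irr] F_closed Z_F.
pose U (s : seq T) := [set p | exists2 t, t \in s & F t p].
have U_cons t s : U (t :: s) = F t `|` U s.
  apply/seteqP; split=> p.
    move=> [u]; rewrite inE => /orP[/eqP-> Ftp|us Fup]; first by left.
    by right; exists u.
  move=> [Ftp|[u us Fup]]; first by exists t; rewrite ?mem_head.
  by exists u; rewrite // inE us orbT.
have U_closed s : {in s, forall t, P t} -> zariski_closed (U s).
  elim: s => [_|t s IHs sP].
    rewrite (_ : U _ = classical_sets.set0); first exact: zariski_closed0.
    by apply/seteqP; split=> // p [t].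
  rewrite U_cons; apply: zariski_closedU; first by apply/F_closed/sP/mem_head.
  by apply: IHs => u us; apply: sP; rewrite inE us orbT.
have U_sub s :
    {in s, forall t, P t} -> Z `<=` U s -> exists2 t, P t & Z `<=` F t.
  elim: s => [_|t s IHs sP]; first by case: Z_n0 => p Zp /(_ p Zp)[].
  have Pt : P t by apply/sP/mem_head.
  have {}sP : {in s, forall t, P t}.
    by move=> u us; apply: sP; rewrite inE us orbT.
  rewrite U_cons => /(Z_irr _ _ (F_closed t Pt) (U_closed s sP))[Z_t|].
    by exists t.
  exact: IHs.
apply: (U_sub [seq t <- enum T | `[< P t >]]) => [t|p /Z_F[t Pt Ftp]].
  by rewrite mem_filter => /andP[/asboolP].
by exists t; rewrite // mem_filter mem_enum andbT; apply/asboolP.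
Qed.

Lemma irreducible_components_bigcup (T : finType) (P : set T)
    (F : T -> set (Spec R)) :
  (forall t, P t -> zariski_closed (F t)) ->
  (forall t, P t -> irreducible (F t)) ->
  (forall t u, P t -> P u -> F t `<=` F u -> t = u) ->
  irreducible_components (\bigcup_(t in P) F t) = F @` P.
Proof.
move=> F_closed F_irr F_anti; apply/seteqP.
split=> [Z [Z_sub Z_irr Z_max]|_ [t Pt <-]].
  have [t Pt Z_t] := irreducible_sub_bigcup Z_irr F_closed Z_sub.
  by exists t => //; apply: Z_max => //; [exact: bigcup_sup|exact: F_irr].
split; [exact: bigcup_sup|exact: F_irr|move=> Z Z_sub Z_irr t_Z].
have [u Pu Z_u] := irreducible_sub_bigcup Z_irr F_closed Z_sub.
have eq_tu : t = u by apply: F_anti => //; apply: subset_trans Z_u.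
by rewrite -eq_tu in Z_u; apply/seteqP; split.
Qed.

End SpectrumTopology.

(** * Coordinate subspaces *)

Section CoordinateSubspaces.

Variables (k : fieldType) (n : nat).
Local Notation S := {mpoly k[n]}.
Implicit Types (V : {set 'I_n}) (f : S).

(** The restriction of polynomial functions to the coordinate subspace of V. *)
Definition restrict_vars V : S -> S :=
  comp_mpoly [tuple if j \in V then 'X_j else 0 | j < n].

HB.instance Definition _ V := GRing.RMorphism.on (restrict_vars V).

Lemma mcoeff_restrict_vars V f m :
  (restrict_vars V f)@_m = if mvars m \subset V then f@_m else 0.
Proof.
have X_V (l : 'X_{1..n}) :
    restrict_vars V 'X_[l] = if mvars l \subset V then 'X_[l] else 0.
  rewrite /restrict_vars comp_mpolyX.
  case: ifPn => [/fintype.subsetP lV|/subsetPn[j]]; last first.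
    rewrite inE => lj /negbTE jV.
    by rewrite (bigD1 j) //= tnth_mktuple jV expr0n (negbTE lj) mul0r.
  rewrite [RHS]mpolyXE_id; apply: eq_bigr => j _; rewrite tnth_mktuple.
  by case: ifPn => // /(contra (lV j)); rewrite inE negbK => /eqP->.
rewrite /restrict_vars comp_mpolyEX raddf_sum /= {3}[f]mpolyE raddf_sum /=.
case: ifP => mV; last rewrite big1 //; last first.
  move=> l _; rewrite mcoeffZ [comp_mpoly _ _]X_V.
  case: ifP => lV; last by rewrite mcoeff0 mulr0.
  by rewrite mcoeffX; case: eqP lV mV => [->->|]; rewrite ?mulr0.
apply: eq_bigr => l _; rewrite !mcoeffZ [comp_mpoly _ _]X_V mcoeffX.
case: ifP => lV.
  by rewrite mcoeffX.
by rewrite mcoeff0; case: eqP lV mV => [->->|].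
Qed.

Lemma restrict_vars_eq0P V f :
  restrict_vars V f = 0 <-> forall m, m \in msupp f -> ~~ (mvars m \subset V).
Proof.
split=> [f0 m|f_V].
  rewrite mcoeff_msupp; apply: contraNN => mV.
  by have := mcoeff_restrict_vars V f m; rewrite mV f0 mcoeff0 => <-.
apply/mpolyP => m; rewrite mcoeff_restrict_vars mcoeff0; case: ifP => // mV.
by apply: memN_msupp_eq0; apply: contraL mV => /f_V.
Qed.

Lemma restrict_varsX V j :
  restrict_vars V 'X_j = if j \in V then 'X_j else 0 :> S.
Proof. by rewrite /restrict_vars comp_mpolyXU -tnth_nth tnth_mktuple. Qed.

Definition face_ideal V : S -> bool := fun f => restrict_vars V f == 0.

Lemma face_ideal_closed V : idealr_closed (face_ideal V).
Proof.
rewrite /face_ideal; split; rewrite ?unfold_in ?rmorph0 ?rmorph1 ?oner_eq0 //.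
move=> a u v; rewrite !unfold_in => /eqP u0 /eqP v0.
by rewrite rmorphD rmorphM /= u0 v0 mulr0 addr0.
Qed.

HB.instance Definition _ V :=
  isIdealr.Build S (face_ideal V) (face_ideal_closed V).

Lemma face_ideal_prime V : prime_idealr_closed (face_ideal V).
Proof. by move=> u v; rewrite !unfold_in /face_ideal rmorphM mulf_eq0. Qed.

HB.instance Definition _ V :=
  isPrimeIdealrClosed.Build S (face_ideal V) (@face_ideal_prime V).

Definition face_point V : Spec S := face_ideal V.

(** Every monomial of an f in the ideal of V is divisible by a variable outside
V, and p contains these variables. *)
Lemma coordinate_subspace_generic V (p : Spec S) :
  coordinate_subspace k V p ->
  forall f, f \in (face_point V : {pred S}) -> f \in (p : {pred S}).
Proof.
move=> Vp f /eqP/restrict_vars_eq0P f_V; rewrite [f]mpolyE.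
rewrite big_seq; apply: rpred_sum => m /f_V/subsetPn[j]; rewrite inE => mj jV.
have le_jm : (U_(j) <= m)%MM by rewrite lep1mP.
rewrite -(submK le_jm) mpolyXD scalerAl; apply: idealMr.
by apply: Vp; exists j.
Qed.

Lemma face_point_in_coordinate_subspace V W :
  coordinate_subspace k V (face_point W) <-> (W \subset V)%SET.
Proof.
split=> [VW|/fintype.subsetP WV f [j jV ->]].
  apply/fintype.subsetP => j jW; apply: contraT => jV.
  have /eqP := VW 'X_j (ex_intro2 _ _ j jV erefl).
  rewrite restrict_varsX jW => Xj0.
  have /eqP := congr1 (mcoeff U_(j)) Xj0.
  by rewrite mcoeffXU mcoeff0 eqxx oner_eq0.
apply/eqP; rewrite restrict_varsX; case: ifP => // /WV.
by rewrite (negbTE jV).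
Qed.

Lemma coordinate_subspaceS V W :
  coordinate_subspace k V `<=` coordinate_subspace k W -> V \subset W.
Proof.
by move=> VW; apply/face_point_in_coordinate_subspace/VW;
  apply/face_point_in_coordinate_subspace.
Qed.

Lemma coordinate_subspace_irreducible V : irreducible (coordinate_subspace k V).
Proof.
apply: (@irreducible_generic_point _ _ (face_point V)).
  exact/face_point_in_coordinate_subspace.
exact: coordinate_subspace_generic.
Qed.

End CoordinateSubspaces.

(** * The annihilator and its zero locus *)

(** A vertex set with nonvanishing homology lies in a maximal one, which puts a
stronger condition on f. *)
Lemma ann_W_restrict_vars (k : fieldType) (n : nat) (D : {set {set 'I_n}})
    (i : nat) (f : {mpoly k[n]}) :
  (0 < i)%N -> ann_W k D i f <->
  forall V, maximal_nonacyclic k D i.-1 V -> restrict_vars V f = 0.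
Proof.
pose nonacyclic W := `[< reduced_homology_neq0 k (restrict D W) i.-1 >].
move=> i_gt0; rewrite ann_W_msuppP //.
split=> [f_V V [/f_V fV _]|f_max V V_nac m m_f]; first exact/restrict_vars_eq0P.
have /(@maxset_exists _ nonacyclic)[W] : nonacyclic V by apply/asboolP.
move=> /maxsetP[/asboolP W_nac W_max] VW.
have /f_max/restrict_vars_eq0P/(_ m m_f) : maximal_nonacyclic k D i.-1 W.
  by split=> // W' /asboolP W'_nac WW'; apply: W_max.
by apply: contra => mV; apply: fintype.subset_trans VW.
Qed.

Theorem theorem1p3 (k : fieldType) (n : nat) (D : {set {set 'I_n}}) (i : nat)
    (char_k : [pchar k] =i pred0) (D_complex : simplicial_complex D)
    (i_ge1 : (1 <= i)%N) :
  [/\ reduced_closed_subscheme (ann_W k D i),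
      support_resonance k D i =
        \bigcup_(V in maximal_nonacyclic k D i.-1) coordinate_subspace k V &
      irreducible_components (support_resonance k D i) =
        coordinate_subspace k @` maximal_nonacyclic k D i.-1].
Proof.
have suppE : support_resonance k D i =
    \bigcup_(V in maximal_nonacyclic k D i.-1) coordinate_subspace k V.
  apply/seteqP; split=> p; last first.
    move=> [V V_max pV] f /(ann_W_restrict_vars _ _ i_ge1)/(_ V V_max) fV.
    by apply: (coordinate_subspace_generic pV); apply/eqP.
  (* Outside every coordinate subspace of the union, p misses a variable x_j,
     j outside V, for each maximal V; the product of these variables lies in
     the annihilator but not in the prime p. *)
  move=> p_ann; apply: contrapT => p_notin.
  have missing V : exists f : {mpoly k[n]}, f \notin (p : {pred _}) /\
      (maximal_nonacyclic k D i.-1 V -> restrict_vars V f = 0).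
    have [V_max|V_nmax] := pselect (maximal_nonacyclic k D i.-1 V); last first.
      by exists 1; split=> //; rewrite idealr1.
    have : ~ coordinate_subspace k V p by move=> pV; apply: p_notin; exists V.
    move=> /existsNP[_ /not_implyP[[j jV ->] /negP j_p]].
    by exists 'X_j; split=> // _; rewrite restrict_varsX (negbTE jV).
  have [g g_P] := choice missing.
  have : \prod_V g V \notin (p : {pred _}).
    apply: (big_ind (fun f => f \notin (p : {pred _}))) => [|f h fp hp|V _].
    - by rewrite idealr1.
    - by rewrite prime_idealrM negb_or fp.
    - exact: (g_P V).1.
  apply/negP; rewrite negbK; apply: p_ann.
  apply/ann_W_restrict_vars => // V V_max.
  by rewrite rmorph_prod (bigD1 V) //= (g_P V).2 // mul0r.
split; [|exact: suppE|].
  (* A denominator s that kills f ^+ m already kills f, as each ideal of the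
     intersection that contains s * f ^+ m contains s or f. *)
  move=> p _ f m [s s_p /(ann_W_restrict_vars _ _ i_ge1) sfm_V].
  exists s => //; apply/ann_W_restrict_vars => // V /sfm_V/eqP.
  rewrite !rmorphM rmorphXn /= mulf_eq0 expf_eq0.
  by case/orP => [|/andP[_]] /eqP->; rewrite ?mul0r ?mulr0.
rewrite suppE; apply: irreducible_components_bigcup.
- by move=> V _; eexists.
- by move=> V _; apply: coordinate_subspace_irreducible.
- move=> V W [_ V_max] [W_nac _] /coordinate_subspaceS VW.
  by rewrite (V_max W).
Qed.
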